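(* For all positive integers $m, n, k$, there is a listing $w^{(1)}, w^{(2)}, \ldots, w^{(N)}$ of the set $\mathcal{B}_k(m,n)$ of $m$-ary words of length $n$ with weight $k$, containing each element of $\mathcal{B}_k(m,n)$ exactly once, such that any two adjacent words $w^{(i)}, w^{(i+1)}$ ($1 \le i < N$) differ in exactly two positions.
   Context: An $m$-ary word (string) of length $n$ is a sequence $x = x_1x_2\ldots x_n$ with each $x_i \in \{0,1,\ldots,m-1\}$. Its weight is $wt(x) = \sum_{i=1}^n x_i$ (sum of integers). $\mathcal{B}_k(m,n)$ denotes the set of all $m$-ary words of length $n$ and weight $k$. The listing is not required to be cyclic (no condition relates the last word to the first); if the set has at most one element the adjacency condition is vacuous. *)

(* Defs.v *)
From mathcomp Require Import all_boot.

Set Implicit Arguments.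
Unset Strict Implicit.
Unset Printing Implicit Defensive.

Definition wt (m n : nat) (x : n.-tuple 'I_m) : nat := \sum_(i < n) tnth x i.

Definition words_of_weight (k m n : nat) : {set n.-tuple 'I_m} :=
  [set x | wt x == k].

Definition diff_positions (m n : nat) (x y : n.-tuple 'I_m) : {set 'I_n} :=
  [set i | tnth x i != tnth y i].

Definition differ_in_two (m n : nat) : rel (n.-tuple 'I_m) :=
  fun x y => #|diff_positions x y| == 2.

(* Main.v *)
Require Import Defs.
From mathcomp Require Import all_boot zify.

(** Sort the words by their first letter [a] and list the tails recursively,
    forwards for even [a] and backwards for odd [a].  Successive blocks then meet
    at tails that are both first words or both last words of their listings, of
    weights [k.+1] and [k], so it is enough that the first word (the
    lexicographically least one) and the last word of the listing each change in
    one position only when the weight changes by one.  Fixing the direction by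
    the parity of [a] itself, rather than by the rank of the block, makes this
    work: a nonzero least letter forces a maximal tail and a greatest letter below
    [m - 1] forces a zero tail, so in these cases the direction is irrelevant, and
    otherwise the extreme letter is [0] or [m - 1], of fixed parity. *)

Section Walk.
Set Implicit Arguments.
Unset Strict Implicit.
Variables (T : eqType) (e : rel T).

(** The endpoints are recorded so that blocks can be glued; an empty list is never a walk, so every
    block contributes both ends. *)
Definition walk (x y : T) (w : seq T) : bool :=
  if w is z :: p then [&& z == x, path e z p & last z p == y] else false.

Lemma walk_sorted x y w : walk x y w -> sorted e w.
Proof. by case: w => //= z p /and3P[]. Qed.

Lemma walk_cat x y x' y' w w' :
  walk x y w -> e y x' -> walk x' y' w' -> walk x y' (w ++ w').
Proof.
case: w w' => [|z p] [|z' p'] //= /and3P[-> pz /eqP ly] eyx /and3P[/eqP-> pz' l'].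
by rewrite cat_path last_cat /= pz ly eyx pz'.
Qed.

Lemma walk_rev x y w : symmetric e -> walk x y w -> walk y x (rev w).
Proof.
move=> e_sym; case: w => //= z p /and3P[/eqP-> pz /eqP <-].
rewrite lastI rev_rcons /= eqxx /=.
rewrite (eq_path (e' := fun z => e^~ z)) ?rev_path ?pz /=; last first.
  by move=> u v; rewrite e_sym.
by case: p {pz} => //= u p; rewrite rev_cons last_rcons.
Qed.

Lemma walk_flatten_iota (B : nat -> seq T) (f l : nat -> T) s t :
    (forall a, s <= a <= s + t -> walk (f a) (l a) (B a)) ->
    (forall a, s <= a < s + t -> e (l a) (f a.+1)) ->
  walk (f s) (l (s + t)) (flatten (map B (iota s t.+1))).
Proof.
elim: t s => [|t IH] s wB el.
  by rewrite /= cats0 addn0; apply: wB; lia.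
have -> : iota s t.+2 = s :: iota s.+1 t.+1 by [].
rewrite map_cons /= -[B s.+1 ++ _]/(flatten (map B (iota s.+1 t.+1))).
apply: (walk_cat (wB s _) (el s _)); try lia.
by rewrite -addSnnS; apply: IH => a ?; [apply: wB|apply: el]; lia.
Qed.

End Walk.

Lemma walk_map {T U : eqType} {e : rel T} {e' : rel U} {f : T -> U} {x y w} :
  {mono f : u v / e u v >-> e' u v} ->
  walk e x y w -> walk e' (f x) (f y) (map f w).
Proof.
move=> fe; case: w => //= z p /and3P[/eqP-> pz /eqP <-].
by rewrite eqxx last_map eqxx path_map (eq_path (e' := e)) ?pz.
Qed.

(** Plain sequences make the recursion on the length easy. The truncation by [zip] is harmless, as
    words listed together have equal length. *)
Definition hamming (x y : seq nat) : nat :=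
  count (fun p => p.1 != p.2) (zip x y).

Lemma hamming_cons a b x y :
  hamming (a :: x) (b :: y) = (a != b) + hamming x y.
Proof. by []. Qed.

Lemma hammingxx x : hamming x x = 0.
Proof. by elim: x => //= a x IH; rewrite hamming_cons eqxx. Qed.

Lemma hamming_sym x y : hamming x y = hamming y x.
Proof.
elim: x y => [|a x IH] [|b y] //.
by rewrite !hamming_cons IH eq_sym.
Qed.

Definition two_apart : rel (seq nat) := fun x y => hamming x y == 2.

Lemma two_apart_sym : symmetric two_apart.
Proof. by move=> x y; rewrite /two_apart hamming_sym. Qed.

Section Gray.
Variable M : nat.

(** With truncated subtraction, [k - n' * M] is the least first letter that leaves a weight the
    other [n'] letters can carry. *)
Fixpoint first_word n k : seq nat :=
  if n is n'.+1 then (k - n' * M) :: first_word n' (k - (k - n' * M)) else [::].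

(** If [k < M], the tail has weight [k - M = 0] and is all zeros, so testing the parity of [M]
    instead of that of [k] does no harm. *)
Fixpoint last_word n k : seq nat :=
  if n is n'.+1 then
    minn k M :: (if odd M then first_word else last_word) n' (k - M)
  else [::].

Fixpoint gray n k : seq (seq nat) :=
  if n is n'.+1 then
    flatten
      [seq map (cons a) ((if odd a then rev else id) (gray n' (k - a)))
         | a <- iota (k - n' * M) ((minn k M).+1 - (k - n' * M))]
  else if k == 0 then [:: [::]] else [::].

Lemma first_word0 n : first_word n 0 = nseq n 0.
Proof. by elim: n => //= n ->. Qed.

Lemma last_word0 n : last_word n 0 = nseq n 0.
Proof.
elim: n => //= n IH; rewrite sub0n min0n.
by case: odd; rewrite ?first_word0 ?IH.
Qed.

Lemma first_word_max n : first_word n (n * M) = nseq n M.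
Proof.
by elim: n => //= n IH; rewrite mulSn addnK addKn IH.
Qed.

Lemma last_word_max n : last_word n (n * M) = nseq n M.
Proof.
elim: n => //= n IH; rewrite mulSn addKn (minn_idPr (leq_addr _ _)).
by case: odd; rewrite ?first_word_max ?IH.
Qed.

(** Either both words start with [0] and the change lies in the tails, or both tails are constantly
    [M] and only the first letter changes. *)
Lemma hamming_first_word n k :
  k < n * M -> hamming (first_word n k.+1) (first_word n k) = 1.
Proof.
elim: n k => // n IH k; rewrite mulSn => ltk.
rewrite /= hamming_cons; case: (ltnP k (n * M)) => [lt|le].
  have -> : k.+1 - n * M = 0 by lia.
  have -> : k - n * M = 0 by lia.
  by rewrite !subn0 IH.
have -> : k.+1 - (k.+1 - n * M) = n * M by lia.
have -> : k - (k - n * M) = n * M by lia.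
by rewrite hammingxx; case: eqP => //; lia.
Qed.

(** Dually, either both tails are zero, or both words start with [M] and the tails change, as first
    words when [M] is odd. *)
Lemma hamming_last_word n k :
  k < n * M -> hamming (last_word n k.+1) (last_word n k) = 1.
Proof.
elim: n k => // n IH k; rewrite mulSn => ltk.
rewrite /= hamming_cons; case: (ltnP k M) => [lt|le].
  have -> : k.+1 - M = 0 by lia.
  have -> : k - M = 0 by lia.
  by rewrite hammingxx; case: eqP => //; lia.
rewrite (minn_idPr (leqW le)).
rewrite eqxx subSn //; case: odd; first by rewrite hamming_first_word //; lia.
by rewrite IH //; lia.
Qed.

Lemma gray_walk {n k} :
  k <= n * M -> walk two_apart (first_word n k) (last_word n k) (gray n k).
Proof.
elim: n k => [|n IH] k; first by rewrite leqn0 => /eqP->.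
rewrite mulSn => lek.
(* [f a] and [l a] are the two ends of block [a], swapped for odd [a] because that block is
   reversed. *)
pose f a := a :: (if odd a then last_word else first_word) n (k - a).
pose l a := a :: (if odd a then first_word else last_word) n (k - a).
have -> : first_word n.+1 k = f (k - n * M).
  (* An odd letter is nonzero, so the tail has the maximal weight [n * M]. *)
  rewrite /f /=; case: ifP => // odd_a; congr cons.
  have -> : k - (k - n * M) = n * M by lia.
  by rewrite first_word_max last_word_max.
have -> : last_word n.+1 k = l (k - n * M + (minn k M - (k - n * M))).
  rewrite subnKC; last by lia.
  rewrite /l /=; case: (leqP M k) => [//|lt]; congr cons.
  have -> : k - M = 0 by lia.
  by rewrite subnn; do 2 case: odd; rewrite ?first_word0 ?last_word0.
rewrite /= subSn; last by lia.
apply: walk_flatten_iota => a a_in.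
  apply: (@walk_map _ _ two_apart).
    by move=> x y; rewrite /two_apart hamming_cons eqxx.
  have := IH (k - a) ltac:(lia).
  by case: odd => //; apply: walk_rev; apply: two_apart_sym.
(* Junction of blocks [a] and [a.+1]: the first letters differ, and by opposite parity the tails are
   both first or both last words, one position apart. *)
rewrite /two_apart hamming_cons /=.
have -> : k - a = (k - a.+1).+1 by lia.
have -> : (a != a.+1) by lia.
by case: odd; rewrite /= ?hamming_first_word ?hamming_last_word //; lia.
Qed.

Lemma gray_sorted n k : sorted two_apart (gray n k).
Proof.
have [/gray_walk/walk_sorted // | ] := leqP k (n * M).
case: n => [|n]; first by case: k.
rewrite mulSn /= => lt.
by have -> : (minn k M).+1 - (k - n * M) = 0 by lia.
Qed.

Lemma sumn_le {n x} : size x = n -> all (leq^~ M) x -> sumn x <= n * M.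
Proof.
by move=> <-; elim: x => //= a x IH /andP[le_a /IH]; rewrite mulSn; lia.
Qed.

Lemma mem_gray n k x :
  (x \in gray n k) = [&& size x == n, all (leq^~ M) x & sumn x == k].
Proof.
have orientE a (s : seq (seq nat)) : (if odd a then rev else id) s =i s.
  by move=> y; case: odd; rewrite ?mem_rev.
elim: n k x => [|n IH] k x.
  by case: x => [|a x] /=; case: k.
apply/flatten_mapP/and3P => [[a] | []].
  rewrite mem_iota => a_in /mapP[y]; rewrite orientE IH.
  move=> /and3P[/eqP <- le_y /eqP sum_y] -> /=; split=> //.
    by rewrite le_y andbT; lia.
  by apply/eqP; lia.
case: x => [//|a x] /=; rewrite eqSS => size_x /andP[le_a le_x] /eqP sum_x.
have := sumn_le (eqP size_x) le_x => sum_le.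
exists a; first by rewrite mem_iota; lia.
apply: map_f; rewrite orientE IH le_x size_x /=.
by apply/eqP; lia.
Qed.

Lemma gray_uniq n k : uniq (gray n k).
Proof.
elim: n k => [|n IH] k /=; first by case: k.
(* Generalize to any duplicate-free list of first letters; distinct letters give disjoint blocks. *)
elim: iota (iota_uniq (k - n * M) ((minn k M).+1 - (k - n * M))) => //= a s IHs.
move=> /andP[a_s /IHs s_uniq]; rewrite cat_uniq s_uniq andbT.
rewrite map_inj_uniq; last by move=> x y [].
apply/andP; split; first by case: odd; rewrite ?rev_uniq IH.
apply/hasPn => x /flatten_mapP[b b_s /mapP[y _ ->]].
by apply: contra a_s => /mapP[z _ [<- _]].
Qed.

End Gray.

Lemma card_diff_positions m n (x y : n.-tuple 'I_m) :
  #|diff_positions x y| = hamming (map val x) (map val y).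
Proof.
rewrite /diff_positions cardsE cardE /enum_mem size_filter /hamming.
rewrite -[in RHS](map_tnth_enum x) -[in RHS](map_tnth_enum y).
rewrite -(map_comp val (tnth x)) -(map_comp val (tnth y)) zip_map [in RHS]count_map.
by rewrite enumT; apply: eq_count.
Qed.

Lemma wt_sumn m n (x : n.-tuple 'I_m) : wt x = sumn (map val x).
Proof. by rewrite /wt sumnE big_map big_tuple. Qed.

Theorem theorem2p6 (m n k : nat) (hm : 0 < m) (hn : 0 < n) (hk : 0 < k) :
  exists w : seq (n.-tuple 'I_m),
    [/\ uniq w,
        w =i words_of_weight k m n
      & sorted (@differ_in_two m n) w].
Proof.
case: m hm => // M _.
pose val_seq (t : n.-tuple 'I_M.+1) : seq nat := map val t.
pose to_tuple s : n.-tuple 'I_M.+1 := [tuple inord (nth 0 s i) | i < n].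
have val_seq_inj : injective val_seq.
  by move=> t u /(inj_map val_inj)/val_inj.
(* On listed words neither [inord] nor the default [0] loses anything, so all three properties
   transfer back along [val_seq]. *)
have to_tupleK : map val_seq (map to_tuple (gray M n k)) = gray M n k.
  rewrite -map_comp -[RHS]map_id; apply/eq_in_map => s.
  rewrite mem_gray => /and3P[/eqP size_s /allP le_s _].
  apply: (@eq_from_nth _ 0) => [|i]; rewrite /= size_map size_tuple // => lt_i.
  rewrite (nth_map ord0) ?size_tuple // -(tnth_nth _ _ (Ordinal lt_i)).
  by rewrite tnth_mktuple /= inordK // ltnS le_s ?mem_nth ?size_s.
exists (map to_tuple (gray M n k)); split.
- by apply: (@map_uniq _ _ val_seq); rewrite to_tupleK gray_uniq.
- move=> t; rewrite -(mem_map val_seq_inj) to_tupleK mem_gray inE wt_sumn.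
  rewrite size_map size_tuple eqxx /=.
  suff -> : all (leq^~ M) (val_seq t) by [].
  by apply/allP => _ /mapP[i _ ->]; rewrite -ltnS ltn_ord.
- have := gray_sorted M n k; rewrite -[X in sorted two_apart X]to_tupleK sorted_map.
  apply: sub_sorted => t u.
  by rewrite /differ_in_two card_diff_positions.
Qed.
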